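(* For all integers $n\geq 0$ and $i\geq 1$, $$\bar a_{3i+2}(3n+2)\equiv 0 \pmod 6,\qquad \bar a_{9i+5}(9n+3)\equiv 0 \pmod{12},\qquad \bar a_{9i+8}(9n+3)\equiv 0 \pmod{12}.$$
   Context: For $|q|<1$ and integers $m\geq 1$, write $f_m:=\prod_{j\geq 1}(1-q^{jm})$. For an integer $c\geq 1$, the generalized overcubic partition function $\bar a_c(n)$ is defined by $$\sum_{n\geq 0}\bar a_c(n)q^n=\frac{f_4^{c-1}}{f_1^2f_2^{2c-3}}.$$ *)

(* Defs.v *)
From mathcomp Require Import all_boot all_order all_algebra.
Set Implicit Arguments. Unset Strict Implicit. Unset Printing Implicit Defensive.
Import GRing.Theory Num.Theory.
Local Open Scope ring_scope.

(* Truncations (exact modulo q^(N+1), for m >= 1) of f_m = prod_{j>=1} (1 - q^{jm})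
   and of 1/f_m = prod_{j>=1} sum_{t>=0} q^{jmt}, as integer polynomials. *)
Definition fm_trunc (N m : nat) : {poly int} :=
  \prod_(1 <= j < N.+1) (1 - 'X^(j * m)).
Definition fm_inv_trunc (N m : nat) : {poly int} :=
  \prod_(1 <= j < N.+1) \sum_(0 <= t < N.+1) 'X^(j * m * t).

Definition fm_pow_trunc (N m : nat) (e : int) : {poly int} :=
  match e with
  | Posz k => fm_trunc N m ^+ k
  | Negz k => fm_inv_trunc N m ^+ k.+1
  end.

Definition abar (c n : nat) : int :=
  (fm_pow_trunc n 4 (c%:Z - 1) * fm_pow_trunc n 1 (-2)
     * fm_pow_trunc n 2 (- (2 * c%:Z - 3)))`_n.

(* Main.v *)
(* Put phi(q) = sum_k q^(k^2). Gauss' identities phi(-q) = f_1^2/f_2 and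
   phi(q) = f_2^5/(f_1^2 f_4^2), both limits of the q-binomial theorem, turn the
   generating function of abar_c into phi(q) / phi(-q^2)^(c+1).
   Modulo 3, cubing replaces q by q^3. So for c = 3i+2 the series is phi(q) times
   a series in q^3, and squares are never 2 mod 3. For c = 9i+8 it is phi(q) times
   a series in q^9, and for c = 9i+5 it is phi(q) phi(-q^6) times a series in q^9,
   while neither x^2 nor x^2 + 6y^2 is ever 3 mod 9.
   Modulo 2 we have phi = 1, and modulo 4 we have phi^2 = 1, so that the series is
   phi(q) or phi(q) + phi(-q^2) - 1, whose exponents x^2, 2x^2 avoid 3 mod 9. *)
Require Import Defs.
From mathcomp Require Import all_boot all_order all_algebra.
From mathcomp Require Import ring zify.
From Stdlib Require Import Setoid Morphisms.

Set Implicit Arguments. Unset Strict Implicit. Unset Printing Implicit Defensive.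
Import GRing.Theory Num.Theory.
Local Open Scope ring_scope.

(** * Gaussian binomials and the finite q-binomial theorem *)

Section QBinomial.
Variables (R : comNzRingType) (Q : R).

Fixpoint qbin n k : R :=
  match n, k with
  | _, 0%N => 1
  | 0%N, _.+1 => 0
  | n'.+1, k'.+1 => qbin n' k' + Q ^+ k'.+1 * qbin n' k'.+1
  end.

Definition qfact n : R := \prod_(1 <= j < n.+1) (1 - Q ^+ j).

Lemma qbin0 n : qbin n 0 = 1. Proof. by case: n. Qed.

Lemma qbin_small n k : (n < k)%N -> qbin n k = 0.
Proof.
elim: n k => [|n IHn] [|k] //= lt_nk.
by rewrite !IHn ?mulr0 ?addr0 // ltnW.
Qed.

(** Splitting off the factor [j = 0] replaces [t] by [t * Q] in the rest of the product; the Pascal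
    rule then recombines the two sums. *)
Lemma qbin_theorem n (a t : R) :
  \prod_(j < n) (a + t * Q ^+ j) =
  \sum_(k < n.+1) Q ^+ 'C(k, 2) * qbin n k * t ^+ k * a ^+ (n - k).
Proof.
elim: n t => [|n IHn] t.
  by rewrite big_ord0 big_ord1 /= !expr0 !mulr1.
rewrite big_ord_recl expr0 mulr1.
under eq_bigr => j _ do rewrite lift0 exprS mulrA.
rewrite IHn mulrDl [RHS]big_ord_recl expr0 subn0 qbin0 !mulr1 mul1r.
under [in RHS]eq_bigr => k _.
  rewrite lift0 /= subSS mulrDr !mulrDl. over.
rewrite big_split /= [RHS]addrCA [LHS]addrC !mulr_sumr; congr (_ + _).
  apply: eq_bigr => k _.
  rewrite binS bin1 exprD exprMn exprS; ring.
rewrite big_ord_recl expr0 subn0 qbin0 !mulr1 !mul1r -exprS; congr (_ + _).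
rewrite [RHS]big_ord_recr /= qbin_small // !(mulr0, mul0r) addr0.
apply: eq_bigr => k _; rewrite /bump /= add1n.
have -> : (n - k = (n - k.+1).+1)%N by have := ltn_ord k; lia.
rewrite exprMn [a ^+ _.+1]exprS; ring.
Qed.

Lemma qfactS n : qfact n.+1 = qfact n * (1 - Q ^+ n.+1).
Proof. by rewrite /qfact big_nat_recr. Qed.

(** Induction on [a + b] by the Pascal rule, from 1 - Q^(a+b) = (1 - Q^a) + Q^a (1 - Q^b). *)
Lemma qbin_fact a b : qbin (a + b) a * qfact a * qfact b = qfact (a + b).
Proof.
have qf0 : qfact 0 = 1 by rewrite /qfact big_geq.
have qbb n : qbin n n = 1.
  by elim: n => //= n ->; rewrite qbin_small // mulr0 addr0.
move Dn: (a + b)%N => n; elim: n a b Dn => [|n IHn] [|a] [|b] // Dn;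
  rewrite ?qbin0 ?qf0 ?mulr1 ?mul1r //; try by rewrite -Dn ?addn0 ?qbb ?mul1r ?add0n.
have Da : (a + b.+1 = n)%N by lia.
have Db : (a.+1 + b = n)%N by lia.
have IHa := IHn _ _ Da; have IHb := IHn _ _ Db.
rewrite /= [LHS](_ : _ = qbin n a * qfact a * qfact b.+1 * (1 - Q ^+ a.+1)
   + Q ^+ a.+1 * (1 - Q ^+ b.+1) * (qbin n a.+1 * qfact a.+1 * qfact b)).
  by rewrite IHa IHb [qfact n.+1]qfactS -Dn exprD; ring.
rewrite [qfact b.+1]qfactS [qfact a.+1]qfactS; ring.
Qed.

End QBinomial.

(** * Calculus of truncated power series modulo an integer *)

(* Congruence modulo the ideal (q^(N+1), M); M = 0 gives equality of truncated series. *)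
Definition congX (N M : nat) (p q : {poly int}) : Prop :=
  exists r s, p = q + 'X^(N.+1) * r + M%:R * s.

Section CongX.
Variables N M : nat.
Local Notation cong := (congX N M).

Lemma congX_refl p : cong p p.
Proof. by exists 0, 0; rewrite !mulr0 !addr0. Qed.

Lemma eq_congX p q : p = q -> cong p q.
Proof. by move->; exact: congX_refl. Qed.

Lemma congX_sym p q : cong p q -> cong q p.
Proof. by case=> r [s ->]; exists (- r), (- s); ring. Qed.

Lemma congX_trans p q u : cong p q -> cong q u -> cong p u.
Proof. by case=> r [s ->] [r' [s' ->]]; exists (r' + r), (s' + s); ring. Qed.

#[global] Instance congX_equiv : Equivalence cong.
Proof. split; [exact: congX_refl|exact: congX_sym|exact: congX_trans]. Qed.

Lemma congXD p p' q q' : cong p p' -> cong q q' -> cong (p + q) (p' + q').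
Proof. by case=> r [s ->] [r' [s' ->]]; exists (r + r'), (s + s'); ring. Qed.

Lemma congXB p p' q q' : cong p p' -> cong q q' -> cong (p - q) (p' - q').
Proof. by case=> r [s ->] [r' [s' ->]]; exists (r - r'), (s - s'); ring. Qed.

Lemma congXM p p' q q' : cong p p' -> cong q q' -> cong (p * q) (p' * q').
Proof.
case=> r [s ->] [r' [s' ->]].
exists (p' * r' + r * (q' + 'X^(N.+1) * r' + M%:R * s')),
       (p' * s' + s * (q' + M%:R * s') + 'X^(N.+1) * r' * s).
ring.
Qed.

Lemma congXX n p q : cong p q -> cong (p ^+ n) (q ^+ n).
Proof.
by move=> pq; elim: n => [|n IHn]; [exact: congX_refl|rewrite !exprS; exact: congXM].
Qed.

#[global] Instance mul_proper : Proper (cong ==> cong ==> cong) (@GRing.mul _).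
Proof. by move=> p p' Hp q q' Hq; exact: congXM. Qed.

#[global] Instance add_proper : Proper (cong ==> cong ==> cong) (@GRing.add _).
Proof. by move=> p p' Hp q q' Hq; exact: congXD. Qed.

#[global] Instance exp_proper : Proper (cong ==> eq ==> cong) (@GRing.exp _).
Proof. by move=> p p' Hp n _ <-; exact: congXX. Qed.

Lemma congX_coef p q k : cong p q -> (k <= N)%N -> (M %| p`_k - q`_k)%Z.
Proof.
case=> r [s ->] le_kN; rewrite !coefD coefXnM ltnS le_kN addr0 addrAC subrr add0r.
by rewrite -[M%:R]polyC_natr coefCM natz dvdz_mulr.
Qed.

Lemma congX_Xn k : (N < k)%N -> cong 'X^k 0.
Proof. by move=> ltNk; exists 'X^(k - N.+1), 0; rewrite -exprD subnKC // mulr0 addr0 add0r. Qed.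

Lemma congX_natr p : cong (M%:R * p) 0.
Proof. by exists 0, p; rewrite mulr0 !add0r. Qed.

Lemma congX_sum (I : Type) (r : seq I) (P : pred I) (F G : I -> {poly int}) :
  (forall i, P i -> cong (F i) (G i)) ->
  cong (\sum_(i <- r | P i) F i) (\sum_(i <- r | P i) G i).
Proof.
by move=> FG; apply: big_ind2 => //; [exact: congX_refl|exact: congXD].
Qed.

Lemma congX_prod (I : Type) (r : seq I) (P : pred I) (F G : I -> {poly int}) :
  (forall i, P i -> cong (F i) (G i)) ->
  cong (\prod_(i <- r | P i) F i) (\prod_(i <- r | P i) G i).
Proof.
by move=> FG; apply: big_ind2 => //; [exact: congX_refl|exact: congXM].
Qed.

End CongX.

#[local] Hint Resolve congX_refl : core.

Lemma congX_weaken N M p q : congX N 0 p q -> congX N M p q.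
Proof. by case=> r [s ->]; exists r, 0; rewrite mul0r mulr0. Qed.

Lemma congX_comp_Xn N M m p q : (0 < m)%N ->
  congX N M p q -> congX N M (p \Po 'X^m) (q \Po 'X^m).
Proof.
move=> m_gt0 [r [s ->]].
exists ('X^(N.+1 * m - N.+1) * (r \Po 'X^m)), (s \Po 'X^m).
rewrite !comp_polyD !comp_polyM comp_Xn_poly -exprM rmorph_nat mulrA -exprD.
by rewrite subnKC ?leq_pmulr // mulnC.
Qed.

(** * Truncated Euler products and their inverses *)

Lemma fm_truncS N m : fm_trunc N.+1 m = fm_trunc N m * (1 - 'X^(N.+1 * m)).
Proof. by rewrite /fm_trunc big_nat_recr. Qed.

Lemma fm_trunc_qfact N m : fm_trunc N m = qfact 'X^m N.
Proof. by apply: eq_bigr => j _; rewrite -exprM mulnC. Qed.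

Lemma fm_trunc_comp N m k : fm_trunc N m \Po 'X^k = fm_trunc N (m * k).
Proof.
rewrite /fm_trunc rmorph_prod /=; apply: eq_bigr => j _.
by rewrite rmorphB rmorph1 /= comp_Xn_poly -exprM mulnC mulnA.
Qed.

(** Each extra factor 1 - q^(jm) has j > N, so it is 1 modulo q^(N+1). *)
Lemma fm_trunc_stable N M n m :
  (0 < m)%N -> (N <= n)%N -> congX N M (fm_trunc n m) (fm_trunc N m).
Proof.
move=> m_gt0 /subnKC <-; elim: (n - N)%N => [|d IHd]; first by rewrite addn0.
rewrite addnS fm_truncS IHd -[X in congX _ _ _ X]mulr1; apply: congXM => //.
rewrite -[X in congX _ _ _ X]subr0; apply: congXB => //; apply: congX_Xn.
have := leq_pmulr (N + d).+1 m_gt0; lia.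
Qed.

Lemma fm_trunc_invK N M m :
  (0 < m)%N -> congX N M (fm_trunc N m * fm_inv_trunc N m) 1.
Proof.
move=> m_gt0; rewrite -big_split /= big_nat.
apply: (@congX_trans _ _ _ (\prod_(1 <= j < N.+1 | (1 <= j < N.+1)%N) 1)); last by rewrite big1.
apply: congX_prod => j /andP[j_gt0 _].
have -> : (1 - 'X^(j * m)) * \sum_(0 <= t < N.+1) 'X^(j * m * t) =
    1 - 'X^(j * m * N.+1) :> {poly int}.
  rewrite big_mkord (exprM _ (j * m)) -[RHS]opprB subrX1 -mulNr opprB; congr (_ * _).
  by apply: eq_bigr => t _; rewrite (exprM _ (j * m)).
rewrite -[X in congX _ _ _ X]subr0; apply: congXB => //; apply: congX_Xn.
by rewrite mulnC leq_pmulr // muln_gt0 j_gt0.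
Qed.

(** * The finite Jacobi triple product *)

Lemma sum_distn (A : nmodType) (F : nat -> A) n :
  \sum_(k < n.*2.+1) F `|k - n|%N = F 0%N + \sum_(1 <= k < n.+1) F k *+ 2.
Proof.
elim: n => [|n IHn]; first by rewrite big_ord1 big_geq ?addr0.
rewrite doubleS big_ord_recl big_ord_recr /= big_nat_recr //= [RHS]addrA -IHn.
rewrite addrCA; congr (_ + _).
  by apply: eq_bigr => k _; congr F; rewrite /bump /=; lia.
by rewrite mulr2n; congr (F _ + F _); rewrite /bump /=; lia.
Qed.

(** Completes the square in the exponent of the k-th q-binomial term: besides (k - n)^2, what
    remains depends on n alone and can be cancelled. *)
Lemma theta_exponent n k : (k < n.*2.+1)%N ->
  (k * k.-1 + n.*2.-1 * (n.*2 - k) =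
   n * n.-1 + n * n.*2.-1 + `|k%:Z - n%:Z| ^ 2)%N.
Proof.
move=> lt_k.
(* Adding [x] removes the predecessor; the side condition covers [y = 0], where the predecessor
   truncates. *)
have predE x y : (y = 0 -> x = 0)%N -> (x * y.-1 + x = x * y)%N.
  by case: y => [->|y _] //; rewrite mulnS addnC.
have E1 : (k * k.-1 + k = k * k)%N by exact: predE.
have E2 : (n * n.-1 + n = n * n)%N by exact: predE.
have E3 : (n * n.*2.-1 + n = n * n.*2)%N by apply: predE; lia.
have E4 : (n.*2.-1 * (n.*2 - k) + (n.*2 - k) = (n.*2 - k) * n.*2)%N.
  by rewrite [(n.*2.-1 * _)%N]mulnC; apply: predE; lia.
move: (k * k.-1)%N (n * n.-1)%N (n * n.*2.-1)%N (n.*2.-1 * (n.*2 - k))%N E1 E2 E3 E4.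
move=> A B C D; have [le_nk | lt_kn] := leqP n k.
  have -> : `|k%:Z - n%:Z|%N = (k - n)%N by lia.
  have [d Dk] : exists d, k = (n + d)%N by exists (k - n)%N; lia.
  have [m Dn] : exists m, n = (d + m)%N by exists (n - d)%N; lia.
  have -> : (n.*2 - k = m)%N by lia.
  have -> : (k - n = d)%N by lia.
  rewrite -mulnn Dk Dn; lia.
have -> : `|k%:Z - n%:Z|%N = (n - k)%N by lia.
have [d Dn] : exists d, n = (k + d)%N by exists (n - k)%N; lia.
have -> : (n.*2 - k = n + d)%N by lia.
have -> : (n - k = d)%N by lia.
rewrite -mulnn Dn; lia.
Qed.

(** Jacobi's product of (1 + z q^(2j+1))(1 + q^(2j+1)/z) at z = e: as e is its own inverse, the two
    factors coincide, whence the square. *)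
Lemma jacobi_triple_finite (e : {poly int}) n : e * e = 1 ->
  (\prod_(j < n) (1 + e * 'X^(j.*2.+1))) ^+ 2 =
  \sum_(k < n.*2.+1) e ^+ `|k - n|%N * 'X^(`|k - n| ^ 2) * qbin 'X^2 n.*2 k.
Proof.
move=> ee.
have eE k m : ~~ odd (k + m) -> e ^+ k = e ^+ m.
  have eO i : e ^+ i = if odd i then e else 1.
    by elim: i => //= i; rewrite exprS => ->; case: odd; rewrite /= ?mulr1.
  by rewrite !eO oddD; case: odd; case: odd.
have sumE : (\sum_(j < n) j.*2 = n * n.-1)%N.
  by elim: n => [|n IHn]; rewrite ?big_ord0 // big_ord_recr /= IHn; nia.
have cstE (x : {poly int}) : x ^+ n = \prod_(j < n) x by rewrite prodr_const card_ord.
(* Substituting Q = q^2, t = e, a = q^(2n-1) avoids negative powers of q; the common monomial is cancelled at the end. *)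
have := qbin_theorem ('X^2 : {poly int}) n.*2 'X^(n.*2.-1) e.
have -> : \prod_(j < n.*2) ('X^(n.*2.-1) + e * 'X^2 ^+ j) =
  e ^+ n * 'X^(n * n.-1 + n * n.*2.-1) * (\prod_(j < n) (1 + e * 'X^(j.*2.+1))) ^+ 2.
  (* The factors with j < n, read backwards, and those with j >= n each contribute one copy of the
     product. *)
  rewrite -(addnn n) big_split_ord /= [(\prod_(_ < _) _) ^+ 2]expr2 exprD [e ^+ n * _]mulrA mulrACA; congr (_ * _).
    rewrite [in RHS](reindex_inj rev_ord_inj) -sumE expr_sum.
    rewrite cstE -!big_split /=; apply: eq_bigr => j _.
    rewrite mulrDr mulr1 -!exprM addrC mul2n; congr (_ + _).
    rewrite mulrACA ee mul1r -exprD; congr (_ ^+ _); have := ltn_ord j; lia.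
  rewrite mulnC exprM cstE -big_split /=; apply: eq_bigr => j _.
  rewrite mulrDr mulr1 mulrCA -!exprM -exprD; congr (_ + _ * _ ^+ _).
  have := ltn_ord j; lia.
rewrite [RHS](_ : _ = e ^+ n * 'X^(n * n.-1 + n * n.*2.-1) *
  \sum_(k < n.*2.+1) e ^+ `|k - n|%N * 'X^(`|k - n| ^ 2) * qbin 'X^2 n.*2 k); last first.
  rewrite mulr_sumr; apply: eq_bigr => k _.
  rewrite -!exprM (eE k (n + `|k - n|)%N); last by lia.
  have binE : (2 * 'C(k, 2) = k * k.-1)%N by rewrite -mul_bin_diag bin1.
  rewrite binE.
  have expE : (k * k.-1 + n.*2.-1 * (n.*2 - k) =
      n * n.-1 + n * n.*2.-1 + `|k - n| ^ 2)%N.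
    exact: theta_exponent.
  transitivity (e ^+ (n + `|k - n|) * 'X^(k * k.-1 + n.*2.-1 * (n.*2 - k)) * qbin 'X^2 n.*2 k).
    rewrite !exprD; ring.
  rewrite expE !exprD; ring.
apply: mulfI; rewrite mulf_neq0 ?expf_neq0 ?polyX_eq0 //.
by apply/eqP => e0; move: ee; rewrite e0 mul0r => /esym/eqP; rewrite oner_eq0.
Qed.

Lemma fm_inv_trunc_comp N m k : fm_inv_trunc N m \Po 'X^k = fm_inv_trunc N (m * k).
Proof.
rewrite /fm_inv_trunc rmorph_prod /=; apply: eq_bigr => j _.
rewrite rmorph_sum /=; apply: eq_bigr => t _.
by rewrite comp_Xn_poly -exprM; congr ('X^_); lia.
Qed.

(** * Gauss' theta identities and the generating function *)

(* phi(e q) for e = 1 or -1: a partial sum of the sum over all integers k of e^k q^(k^2). *)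
Definition theta (e : int) n : {poly int} :=
  1 + 2 * \sum_(1 <= k < n.+1) e ^+ k *: 'X^(k ^ 2).

Definition oddprod (e : int) n : {poly int} :=
  \prod_(j < n) (1 + e%:P * 'X^(j.*2.+1)).

(** The limit of the finite triple product. It is taken with 2N factors: a term with d = |k - 2N|
    and d^2 <= N then has both k and 4N - k at least N, so f_2 times its q-binomial is 1; the other
    terms vanish modulo q^(N+1). *)
Lemma theta_oddprod N (e : int) : e * e = 1 ->
  congX N 0 (theta e N.*2) (fm_trunc N 2 * oddprod e N.*2 ^+ 2).
Proof.
move=> ee; rewrite jacobi_triple_finite -?polyCM ?ee // mulr_sumr.
have -> : theta e N.*2 =
    \sum_(k < N.*2.*2.+1) e%:P ^+ `|k - N.*2| * 'X^(`|k - N.*2| ^ 2).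
  rewrite (sum_distn (fun k => e%:P ^+ k * 'X^(k ^ 2))) mulr1 /theta mulr_sumr.
  by congr (1 + _); apply: eq_bigr => k _; rewrite mulr_natl -mul_polyC rmorphXn.
apply: congX_sum => k _; apply: congX_sym; set d := `|_|%N.
rewrite mulrCA -[X in congX _ _ _ X]mulr1.
have [lt_Nd | le_dN] := ltnP N (d ^ 2).
  have w0 : congX N 0 (e%:P ^+ d * 'X^(d ^ 2)) 0.
    rewrite -[X in congX _ _ _ X](mulr0 (e%:P ^+ d)); apply: congXM => //.
    exact: congX_Xn.
  by rewrite w0 !mul0r.
apply: congXM => //.
have le_d : (d <= N)%N by apply: leq_trans le_dN; rewrite -mulnn; case: (d) => // d'; lia.
have ltk := ltn_ord k.
have [b Db] : exists b, (N.*2.*2 = k + b)%N by exists (N.*2.*2 - k)%N; lia.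
have [leNk leNb] : (N <= k)%N /\ (N <= b)%N by rewrite /d in le_d; lia.
have := qbin_fact ('X^2 : {poly int}) k b; rewrite -!fm_trunc_qfact -Db => qE.
(* As k, b and 4N are all at least N, each q-factorial in [qE] is f_2 to this precision. *)
have fE : congX N 0 (fm_trunc N 2 * (fm_trunc N 2 * qbin 'X^2 N.*2.*2 k)) (fm_trunc N 2).
  rewrite -{3}(fm_trunc_stable (n := N.*2.*2) _ _ _) //; last by lia.
  rewrite -qE (fm_trunc_stable 0 (n := k)) // (fm_trunc_stable 0 (n := b)) //.
  by apply: eq_congX; ring.
rewrite -[X in congX _ _ X _]mul1r -{1}(fm_trunc_invK N 0 (m := 2)) //.
by rewrite mulrAC fE fm_trunc_invK.
Qed.

Lemma oddprodN1 n : oddprod (-1) n * fm_trunc n 2 = fm_trunc n.*2 1.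
Proof.
elim: n => [|n IHn]; first by rewrite /oddprod /fm_trunc big_ord0 !big_geq ?mulr1.
rewrite doubleS !fm_truncS -IHn /oddprod big_ord_recr /= !muln1.
have -> : (n.+1 * 2 = n.*2.+2)%N by lia.
rewrite polyCN mulNr mul1r; ring.
Qed.

(** Difference of squares gives the factors 1 - q^(4j+2) of f_2; f_4 supplies the others. *)
Lemma oddprod1N1 n :
  oddprod 1 n * oddprod (-1) n * fm_trunc n 4 = fm_trunc n.*2 2.
Proof.
elim: n => [|n IHn]; first by rewrite /oddprod /fm_trunc !big_ord0 !big_geq ?mulr1.
rewrite doubleS !fm_truncS -IHn /oddprod !big_ord_recr /=.
have -> : (n.*2.+1 * 2 = n.*2.+1 + n.*2.+1)%N by lia.
have -> : (n.*2.+2 * 2 = n.+1 * 4)%N by lia.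
rewrite polyCN mulNr mul1r exprD; ring.
Qed.

Lemma congX_oddprodN1 N :
  congX N 0 (oddprod (-1) N.*2 * fm_trunc N 2) (fm_trunc N 1).
Proof.
rewrite -(fm_trunc_stable 0 (n := N.*2) (m := 2)) //; last by lia.
by rewrite oddprodN1 fm_trunc_stable //; lia.
Qed.

Lemma congX_oddprod1N1 N :
  congX N 0 (oddprod 1 N.*2 * oddprod (-1) N.*2 * fm_trunc N 4) (fm_trunc N 2).
Proof.
rewrite -(fm_trunc_stable 0 (n := N.*2) (m := 4)) //; last by lia.
by rewrite oddprod1N1 fm_trunc_stable //; lia.
Qed.

(* Truncations of phi(-q^2) = f_2^2 / f_4 and of its inverse. *)
Definition inv_theta2 N : {poly int} := fm_trunc N 4 * fm_inv_trunc N 2 ^+ 2.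
Definition theta2 N : {poly int} := theta (-1) N.*2 \Po 'X^2.

(** The identity phi(-q) = f_1^2/f_2 is proved in q, then carried to q^2 by substitution. *)
Lemma theta2K N : congX N 0 (theta2 N * inv_theta2 N) 1.
Proof.
have -> : inv_theta2 N = (fm_trunc N 2 * fm_inv_trunc N 1 ^+ 2) \Po 'X^2.
  by rewrite rmorphM rmorphXn /= fm_trunc_comp fm_inv_trunc_comp.
have one : (1 : {poly int}) \Po 'X^2 = 1 by rewrite rmorph1.
rewrite -comp_polyM -[X in congX _ _ _ X]one.
apply: congX_comp_Xn => //.
rewrite theta_oddprod //.
have f1E := congX_oddprodN1 N.
apply: congX_trans (_ : congX N 0 ((fm_trunc N 1 * fm_inv_trunc N 1) ^+ 2) _).
  by rewrite -f1E; apply: eq_congX; ring.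
by rewrite fm_trunc_invK // expr1n.
Qed.

(** Its coefficient of q^N is [abar c N] by conversion, so congruences at precision N apply
    directly. *)
Definition abar_gf N c : {poly int} :=
  fm_pow_trunc N 4 (c%:Z - 1) * fm_pow_trunc N 1 (-2)
     * fm_pow_trunc N 2 (- (2 * c%:Z - 3)).

Lemma abar_gf_theta N c : (1 < c)%N ->
  congX N 0 (abar_gf N c) (theta 1 N.*2 * inv_theta2 N ^+ c.+1).
Proof.
(* With c shifted by 2 the exponents are c+1 >= 0 and -(2c+1) < 0, which selects the branches of
   [fm_pow_trunc]. *)
case: c => [|[|c]] // _; rewrite /abar_gf.
have -> : c.+2%:Z - 1 = Posz c.+1 by lia.
have -> : - (2 * c.+2%:Z - 3) = Negz c.*2 by lia.
have -> : -2 = Negz 1 by [].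
rewrite /= theta_oddprod // /inv_theta2.
have f1E := congX_oddprodN1 N.
have f2E := congX_oddprod1N1 N.
have [K1 K2 K4] : [/\ congX N 0 (fm_trunc N 1 * fm_inv_trunc N 1) 1,
    congX N 0 (fm_trunc N 2 * fm_inv_trunc N 2) 1
  & congX N 0 (fm_trunc N 4 * fm_inv_trunc N 4) 1] by split; exact: fm_trunc_invK.
move: f1E f2E K1 K2 K4.
move: (oddprod 1 _) (oddprod (-1) _) (fm_trunc N 1) (fm_trunc N 2) (fm_trunc N 4).
move: (fm_inv_trunc N 1) (fm_inv_trunc N 2) (fm_inv_trunc N 4).
move=> g1 g2 g4 a b f1 f2 f4 f1E f2E K1 K2 K4.
(* The product of the 1 + q^(2j+1) is f_2^2/(f_1 f_4), so phi(q) = f_2 a^2 = f_2^5/(f_1^2 f_4^2). *)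
have aE : congX N 0 a (f2 ^+ 2 * g1 * g4).
  apply: congX_trans (_ : congX N 0 (a * (f1 * g1) * (f4 * g4)) _).
    by rewrite K1 K4 !mulr1.
  rewrite -f1E.
  apply: congX_trans (_ : congX N 0 ((a * b * f4) * f2 * g1 * g4) _).
    by apply: eq_congX; ring.
  by rewrite f2E.
rewrite aE.
apply: congX_trans
  (_ : congX N 0 (f4 ^+ c.+1 * g1 ^+ 2 * g2 ^+ c.*2.+1 * (f2 * g2) ^+ 5 * (f4 * g4) ^+ 2) _).
  by rewrite K2 K4 !expr1n !mulr1.
apply: eq_congX.
rewrite [(f4 * g2 ^+ 2) ^+ _]exprMn -exprM.
have -> : (2 * c.+3 = c.*2 + 6)%N by lia.
rewrite -[c.+3]addn3 -[c.+1]addn1 -[c.*2.+1]addn1 !exprD; ring.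
Qed.

(** * Frobenius modulo 3, coefficient extraction, reduction modulo 2 and 4 *)

Lemma dvdz_cubeB (a : int) : (3 %| a ^+ 3 - a)%Z.
Proof.
rewrite (divz_eq a 3); have := modz_ge0 a (isT : 3 != 0 :> int).
have := ltz_pmod a (isT : 0 < 3 :> int).
move: (a %/ 3)%Z (a %% 3)%Z => q [[|[|[|r]]]|r] // _ _; apply/dvdzP.
- by exists (9 * q ^+ 3 - q); ring.
- by exists (9 * q ^+ 3 + 9 * q ^+ 2 + 2 * q); ring.
- by exists (9 * q ^+ 3 + 18 * q ^+ 2 + 11 * q + 2); ring.
Qed.

Lemma frobenius3 N p : congX N 3 (p ^+ 3) (p \Po 'X^3).
Proof.
suff [s ->] : exists s, p ^+ 3 = p \Po 'X^3 + 3 * s.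
  by exists 0, s; rewrite mulr0 addr0.
elim/poly_ind: p => [|p a [s IHp]].
  by exists 0; rewrite expr0n /= comp_poly0 mulr0 addr0.
have /dvdzP[b ab] := dvdz_cubeB a.
(* A third of the cross terms of the cube, plus the remainders from the induction hypothesis and
   from a^3 = a + 3b. *)
exists (s * 'X^3 + p ^+ 2 * 'X^2 * a%:P + p * 'X * a%:P ^+ 2 + b%:P).
rewrite comp_polyD comp_polyM comp_polyX comp_polyC.
have aE : a%:P ^+ 3 = a%:P + 3 * b%:P :> {poly int}.
  rewrite -rmorphXn /= -[a ^+ 3](subrK a) ab polyCD polyCM addrC [b%:P * _]mulrC.
  by rewrite [3%:P](rmorph_nat polyC 3).
rewrite -[_ \Po _](addrK (3 * s)) -IHp.
have -> : (p * 'X + a%:P) ^+ 3 = p ^+ 3 * 'X^3 + a%:P ^+ 3 +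
  3 * (p ^+ 2 * 'X^2 * a%:P + p * 'X * a%:P ^+ 2) by ring.
rewrite aE; ring.
Qed.

(** The second factor has only exponents divisible by m, so it pairs q^k with exponents of p in the
    class of k. *)
Lemma coef_mul_comp_Xn (p q : {poly int}) m k : (0 < m)%N ->
  (forall j, (j <= k)%N -> j = k %[mod m] -> p`_j = 0) ->
  (p * (q \Po 'X^m))`_k = 0.
Proof.
move=> m_gt0 p0; rewrite coefM big1 // => -[j /=]; rewrite ltnS => le_jk _.
rewrite coef_comp_poly_Xn //; case: ifP => [/dvdnP[d Dd] | _]; last by rewrite mulr0.
by rewrite p0 ?mul0r // -(subnK le_jk) Dd modnMDl.
Qed.

Lemma coef_theta e n k : (forall x, k <> x ^ 2)%N -> (theta e n)`_k = 0.
Proof.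
move=> nsq; rewrite coefD coef1 -[2]polyC_natr coefCM coef_sum big1 ?mulr0 => [|x _].
  by case: eqP => // k0; case: (nsq 0%N).
by rewrite coefZ coefXn; case: eqP => [/nsq|]; rewrite ?mulr0.
Qed.

Lemma coef_theta2 N k : (forall x, k <> 2 * x ^ 2)%N -> (theta2 N)`_k = 0.
Proof.
move=> nsq; rewrite coef_comp_poly_Xn //; case: ifP => // /dvdnP[d Dk].
by rewrite Dk mulnK // coef_theta // => x Dd; apply: (nsq x); rewrite Dk Dd mulnC.
Qed.

Lemma congX_coef0 N M p q :
  congX N M p q -> q`_N = 0 -> (M %| p`_N)%Z.
Proof. by move/congX_coef => /(_ _ (leqnn N)) + qN; rewrite qN subr0. Qed.

(** If theta^(k+1) = 1 then theta^k is the inverse; used with k = 0 modulo 2 and k = 1 modulo 4. *)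
Lemma inv_theta2_mod N M k :
  congX N M (theta2 N ^+ k.+1) 1 -> congX N M (inv_theta2 N) (theta2 N ^+ k).
Proof.
move=> tk; rewrite -[X in congX _ _ X _]mul1r -tk exprSr -mulrA.
by rewrite (congX_weaken M (theta2K N)) mulr1.
Qed.

Lemma abar_gf_mod2 N c : (1 < c)%N -> congX N 2 (abar_gf N c) 1.
Proof.
move=> c_gt1; rewrite (congX_weaken 2 (abar_gf_theta N c_gt1)).
have t1 e n : congX N 2 (theta e n) 1.
  by rewrite /theta (congX_natr N 2) addr0.
rewrite t1 mul1r (inv_theta2_mod (k := 0)) ?expr0 ?expr1n // expr1.
have one : (1 : {poly int}) \Po 'X^2 = 1 by rewrite rmorph1.
by rewrite -[X in congX _ _ _ X]one; apply: congX_comp_Xn.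
Qed.

Lemma abar_gf_mod4 N c : (1 < c)%N ->
  congX N 4 (abar_gf N c)
    (if odd c then theta 1 N.*2 else theta 1 N.*2 + theta2 N - 1).
Proof.
move=> c_gt1; rewrite (congX_weaken 4 (abar_gf_theta N c_gt1)).
have [u uE] : exists u, theta2 N = 1 + 2 * u.
  by rewrite /theta2 /theta rmorphD rmorph1 rmorphM rmorph_nat; eexists.
have t2 : congX N 4 (theta2 N ^+ 2) 1.
  by exists 0, (u + u ^+ 2); rewrite uE; ring.
rewrite (inv_theta2_mod t2) expr1 -(odd_double_half c.+1) /=.
rewrite exprD -(mul2n (uphalf c)) exprM t2 expr1n mulr1; case: (odd c) => /=.
  by rewrite expr0 mulr1.
(* (1 + 2s)(1 + 2u) exceeds (1 + 2s) + (1 + 2u) - 1 by 4su. *)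
rewrite expr1; exists 0, ((\sum_(1 <= k < N.*2.+1) 1 ^+ k *: 'X^(k ^ 2)) * u).
by rewrite /theta uE; ring.
Qed.

(** * Squares modulo 3 and 9 *)

Lemma sqr_mod3 x : (x ^ 2 %% 3 != 2)%N.
Proof. by rewrite -modnXm; case: (x %% 3)%N (ltn_pmod x (isT : 0 < 3)%N) => [|[|[]]]. Qed.

(** By hand: 3 would divide x, leaving 6y^2 = 3 modulo 9, that is y^2 = 2 modulo 3. Here all
    residues are checked. *)
Lemma sqr_mod9 x y : ((x ^ 2 + 6 * y ^ 2) %% 9 != 3)%N.
Proof.
rewrite -modnDm -(modnMmr 6) -modnXm -(modnXm 2 9 y).
case: (x %% 9)%N (ltn_pmod x (isT : 0 < 9)%N) => [|[|[|[|[|[|[|[|[|]]]]]]]]] //= _;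
by case: (y %% 9)%N (ltn_pmod y (isT : 0 < 9)%N) => [|[|[|[|[|[|[|[|[|]]]]]]]]].
Qed.

Lemma dbl_sqr_mod9 x : (2 * x ^ 2 %% 9 != 3)%N.
Proof.
rewrite -modnMmr -modnXm.
by case: (x %% 9)%N (ltn_pmod x (isT : 0 < 9)%N) => [|[|[|[|[|[|[|[|[|]]]]]]]]].
Qed.

Lemma coef_theta_3mod9 N e n k : (k %% 9 = 3)%N ->
  (theta e n)`_k = 0 /\ (theta2 N)`_k = 0.
Proof.
move=> k3; split.
  apply: coef_theta => x kx; have := sqr_mod9 x 0; rewrite exp0n // muln0 addn0.
  by rewrite -kx k3.
by apply: coef_theta2 => x kx; have := dbl_sqr_mod9 x; rewrite -kx k3.
Qed.

(** A positive multiplier bounds x by k, so the search is finite. *)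
Lemma sqr_dec a k :
  (exists x, k = a.+1 * x ^ 2)%N \/ (forall x, k <> a.+1 * x ^ 2)%N.
Proof.
have [/existsP[x /eqP kx] | /existsPn no] := boolP [exists x : 'I_k.+1, k == a.+1 * x ^ 2]%N.
  by left; exists x.
right=> x kx; have lt_xk : (x < k.+1)%N by rewrite kx -mulnn; nia.
by have /eqP := no (Ordinal lt_xk).
Qed.

(** * Divisibility by 3 and by 4, and their combination *)

Lemma abar_3i2_dvd3 i n : (3 %| abar (3 * i + 2) (3 * n + 2))%Z.
Proof.
set c := (3 * i + 2)%N; set N := (3 * n + 2)%N.
have c_gt1 : (1 < c)%N by lia.
apply: (congX_coef0 (congX_trans (congX_weaken 3 (abar_gf_theta N c_gt1)) _)).
  have -> : (c.+1 = 3 * i.+1)%N by lia.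
  by rewrite exprM frobenius3 -rmorphXn; exact: congX_refl.
apply: coef_mul_comp_Xn => // j _ jN; apply: coef_theta => x jx.
by have := sqr_mod3 x; rewrite -jx jN /N; lia.
Qed.

Lemma inv_theta2_expr9 N i :
  congX N 3 (inv_theta2 N ^+ (9 * i)) (inv_theta2 N ^+ i \Po 'X^9).
Proof.
have E9 : congX N 3 (inv_theta2 N ^+ 9) (inv_theta2 N \Po 'X^9).
  apply: congX_trans (_ : congX N 3 ((inv_theta2 N \Po 'X^3) ^+ 3) _).
    by rewrite (exprM _ 3 3); apply: congXX; exact: frobenius3.
  by apply: congX_trans (frobenius3 _ _) _; rewrite -comp_polyA comp_Xn_poly -exprM.
by rewrite exprM E9 -rmorphXn.
Qed.

Lemma abar_9i8_dvd3 i n : (3 %| abar (9 * i + 8) (9 * n + 3))%Z.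
Proof.
set c := (9 * i + 8)%N; set N := (9 * n + 3)%N.
have c_gt1 : (1 < c)%N by lia.
apply: (congX_coef0 (congX_trans (congX_weaken 3 (abar_gf_theta N c_gt1)) _)).
  have -> : (c.+1 = 9 * i.+1)%N by lia.
  by rewrite inv_theta2_expr9.
apply: coef_mul_comp_Xn => // j _ jN.
by have [] := @coef_theta_3mod9 N 1 N.*2 j; rewrite // jN /N; lia.
Qed.

Lemma abar_9i5_dvd3 i n : (3 %| abar (9 * i + 5) (9 * n + 3))%Z.
Proof.
set c := (9 * i + 5)%N; set N := (9 * n + 3)%N.
have c_gt1 : (1 < c)%N by lia.
apply: (congX_coef0 (congX_trans (congX_weaken 3 (abar_gf_theta N c_gt1)) _)).
  (* Since c + 1 = 9(i+1) - 3, three factors phi(-q^2) complete the power to a multiple of 9; their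
     cube becomes phi(-q^6). *)
  apply: congX_trans (_ : congX N 3 (theta 1 N.*2 * (theta2 N ^+ 3 * inv_theta2 N ^+ (9 * i.+1))) _).
    have -> : (9 * i.+1 = 3 + c.+1)%N by lia.
    rewrite exprD [theta2 N ^+ 3 * _]mulrA -exprMn.
    by rewrite (congX_weaken 3 (theta2K N)) expr1n mul1r.
  by rewrite inv_theta2_expr9 frobenius3 mulrA.
apply: coef_mul_comp_Xn => // j _ jN.
have {}jN : (j %% 9 = 3)%N by rewrite jN /N; lia.
rewrite coefM big1 // => -[l /=]; rewrite ltnS => le_lj _.
rewrite coef_comp_poly_Xn //; case: ifP => [/dvdnP[d Dd] | _]; last by rewrite mulr0.
rewrite Dd mulnK //.
(* A nonzero term needs l = x^2 and d = 2y^2, hence j = x^2 + 6y^2. *)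
have [[x lx] | nsq] := sqr_dec 0 l; last by rewrite coef_theta ?mul0r // => x; rewrite -[(x ^ 2)%N]mul1n.
have [[y dy] | /coef_theta2->] := sqr_dec 1 d; last by rewrite mulr0.
have Dj : (x ^ 2 + 6 * y ^ 2 = j)%N by rewrite -(subnKC le_lj) Dd dy lx; lia.
by have := sqr_mod9 x y; rewrite Dj jN.
Qed.

Lemma abar_dvd4 c n : (1 < c)%N -> (4 %| abar c (9 * n + 3))%Z.
Proof.
move=> c_gt1; set N := (9 * n + 3)%N.
apply: (congX_coef0 (abar_gf_mod4 N c_gt1)).
have [|t0 t20] := @coef_theta_3mod9 N 1 N.*2 N; first by rewrite /N; lia.
(* The constant -1 only touches the coefficient of q^0, and N >= 3. *)
case: odd; rewrite // coefB coefD t0 t20 coef1 /N.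
by case: eqP => //; lia.
Qed.

Theorem theorem1p2 (n i : nat) (hi : (1 <= i)%N) :
  [/\ (6 %| abar (3 * i + 2) (3 * n + 2))%Z,
      (12 %| abar (9 * i + 5) (9 * n + 3))%Z
    & (12 %| abar (9 * i + 8) (9 * n + 3))%Z].
Proof.
split.
- rewrite -[6]/(2%:Z * 3%:Z) Gauss_dvdz // abar_3i2_dvd3 andbT.
  apply: (congX_coef0 (abar_gf_mod2 _ _)); first by lia.
  by rewrite coef1; case: eqP => //; lia.
- by rewrite -[12]/(4%:Z * 3%:Z) Gauss_dvdz // abar_9i5_dvd3 abar_dvd4 //; lia.
by rewrite -[12]/(4%:Z * 3%:Z) Gauss_dvdz // abar_9i8_dvd3 abar_dvd4 //; lia.
Qed.
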